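(* Fix a sub-Gaussian parameter $\sigma>0$. There exist constants $c,K>0$ (depending only on $\sigma$) such that the following holds. Let $n,m,N\ge 1$ be integers, $\beta\in(0,\infty)$, let $C\in\mathbb{R}^{n\times n}$ and $A_1,\dots,A_m\in\mathbb{R}^{n\times n}$ be symmetric, let $\boldsymbol{\lambda}\in\mathbb{R}^m$, and let $X=X(\boldsymbol{\lambda})$, $Y=Y(\boldsymbol{\lambda})=X^{1/2}$ be as defined in the context (with either of the two choices of $X(\boldsymbol\lambda)$). Let $\delta\in(0,1/2]$, and let $z^{(1)},\dots,z^{(N)}$ be i.i.d. random vectors in $\mathbb{R}^n$ whose entries are themselves i.i.d. sub-Gaussian random variables with sub-Gaussian parameter $\sigma$, mean zero and unit variance. Let $$a_i^{(N)}(\boldsymbol{\lambda}) = \frac1N\sum_{j=1}^N \big[Yz^{(j)}\big]^\top A_i\big[Yz^{(j)}\big],\qquad i=1,\dots,m.$$ If $N> c\log\left(\frac{m}{\delta}\right)$, then with probability at least $1-\delta$ the inequality $$\big|a_i^{(N)}(\boldsymbol{\lambda})-\mathrm{Tr}[A_iX(\boldsymbol{\lambda})]\big|\le K\sqrt{\log\left(\frac m\delta\right)}\ \sqrt{\frac{\mathrm{Tr}[A_iXA_iX]}{N}}$$ holds for all $i=1,\dots,m$. Moreover, in the case $m=n$ and $A_i=e_ie_i^\top$ for $i=1,\dots,n$ (with $e_i$ the standard basis vectors of $\mathbb{R}^n$), writing $\mathbf{a}^{(N)}(\boldsymbol\lambda)=(a^{(N)}_1(\boldsymbol\lambda),\dots,a^{(N)}_n(\boldsymbol\lambda))$,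 if $N>c\log\left(\frac n\delta\right)$ then with probability at least $1-\delta$, $$\frac{\big\|\mathbf{a}^{(N)}(\boldsymbol{\lambda})-\mathrm{diag}[X(\boldsymbol{\lambda})]\big\|_2}{\big\|\mathrm{diag}[X(\boldsymbol{\lambda})]\big\|_2}\le K\sqrt{\frac{\log\left(\frac n\delta\right)}{N}}.$$
   Context: For symmetric matrices $C,A_1,\dots,A_m\in\mathbb{R}^{n\times n}$, $\boldsymbol\lambda\in\mathbb{R}^m$ and $\beta>0$, write $\boldsymbol\lambda\cdot\mathbf{A}=\sum_{i=1}^m\lambda_iA_i$. The matrix $X(\boldsymbol\lambda)$ is the symmetric positive definite matrix given by one of the following two choices: (i) (von Neumann entropic regularization) $X(\boldsymbol\lambda)=e^{-\beta(C-\boldsymbol\lambda\cdot\mathbf{A})}$; (ii) (binary entropic regularization) $X(\boldsymbol\lambda)=\big[I+e^{\beta(C-\boldsymbol\lambda\cdot\mathbf{A})}\big]^{-1}$. $Y(\boldsymbol\lambda)=X(\boldsymbol\lambda)^{1/2}$ is its symmetric positive definite square root. For a square matrix $M$, $\mathrm{diag}[M]$ denotes the vector of diagonal entries of $M$. A mean-zero random variable $\xi$ is sub-Gaussian with parameter $\sigma$ if $\mathbb{E}[e^{t\xi}]\le e^{\sigma^2t^2/2}$ for all $t\in\mathbb{R}$. *)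

(* Defs.v *)
From HB Require Import structures.
From mathcomp Require Import all_boot all_order all_algebra.
From mathcomp Require Import all_classical all_reals all_analysis.

Set Implicit Arguments.
Unset Strict Implicit.
Unset Printing Implicit Defensive.

Import Order.TTheory GRing.Theory Num.Theory.
Import numFieldNormedType.Exports.

Local Open Scope classical_set_scope.
Local Open Scope ring_scope.

Section matrices.
Context {R : realType} {n : nat}.

Definition mx_exp (M : 'M[R]_n) : 'M[R]_n :=
  limn (series (fun k : nat => k`!%:R^-1 *: M ^+ k)).

Definition symmetric_mx (M : 'M[R]_n) : Prop := M^T = M.

Definition posdef_mx (M : 'M[R]_n) : Prop :=
  symmetric_mx M /\
  forall v : 'cV[R]_n, v != 0 -> 0 < (v^T *m M *m v) 0 0.

(* A positive definite matrix has exactly one positive definite square root,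
   so this predicate pins down [Y = X^(1/2)]. *)
Definition is_posdef_sqrt (X Y : 'M[R]_n) : Prop :=
  posdef_mx Y /\ Y *m Y = X.

Definition diag_vec (M : 'M[R]_n) : 'cV[R]_n := \col_i M i i.

(* The library norm [`|v|] on matrices is the maximum norm. *)
Definition norm2 (v : 'cV[R]_n) : R := Num.sqrt (\sum_i v i 0 ^+ 2).

End matrices.

Inductive regularization := von_neumann | binary.

Section dual_matrix.
Context {R : realType} {n m : nat}.

Definition lincomb_mx (A : 'I_m -> 'M[R]_n) (lambda : 'cV[R]_m) : 'M[R]_n :=
  \sum_i lambda i 0 *: A i.

Definition X_mx (r : regularization) (beta : R) (C : 'M[R]_n)
    (A : 'I_m -> 'M[R]_n) (lambda : 'cV[R]_m) : 'M[R]_n :=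
  let H := C - lincomb_mx A lambda in
  match r with
  | von_neumann => mx_exp (- beta *: H)
  | binary => invmx (1%:M + mx_exp (beta *: H))
  end.

End dual_matrix.

Section probability_notions.
Context {d : measure_display} {T : measurableType d} {R : realType}
  {P : probability T R}.

Definition mutually_independent {d'} {T' : measurableType d'} {I : finType}
    (X : I -> {RV P >-> T'}) : Prop :=
  forall (J : {set I}) (B : I -> set T'),
    (forall i, i \in J -> measurable (B i)) ->
    P (\bigcap_(i in [set` J]) (X i @^-1` B i)) =
    (\prod_(i in J) P (X i @^-1` B i))%E.

Definition identically_distributed {d'} {T' : measurableType d'} {I : Type}
    (X : I -> {RV P >-> T'}) : Prop :=
  forall i j (B : set T'), measurable B ->
    distribution P (X i) B = distribution P (X j) B.

Definition iid {d'} {T' : measurableType d'} {I : finType}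
    (X : I -> {RV P >-> T'}) : Prop :=
  mutually_independent X /\ identically_distributed X.

Definition sub_gaussian (sigma : R) (xi : {RV P >-> R}) : Prop :=
  forall t : R,
    (mmt_gen_fun P xi t <= (expR (sigma ^+ 2 * t ^+ 2 / 2))%:E)%E.

Section entries.
Context {n : nat}.

Definition entry (z : {RV P >-> n.-tuple R}) (i : 'I_n) : T -> R :=
  fun x => tnth (z x) i.

Lemma measurable_entry z i : measurable_fun setT (entry z i).
Proof.
exact: (measurableT_comp (measurable_tnth i) (measurable_funP z)).
Qed.

HB.instance Definition _ z i :=
  isMeasurableFun.Build _ _ _ _ (entry z i) (measurable_entry z i).

Definition entry_RV (z : {RV P >-> n.-tuple R}) (i : 'I_n) : {RV P >-> R} :=
  entry z i.

Definition vec_of (z : {RV P >-> n.-tuple R}) (x : T) : 'cV[R]_n :=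
  \col_i entry z i x.

Definition iid_sub_gaussian_sample (sigma : R) (N : nat)
    (z : 'I_N -> {RV P >-> n.-tuple R}) : Prop :=
  iid z /\
  forall j, iid (entry_RV (z j)) /\
    forall i, [/\ ('E_P[entry_RV (z j) i] = 0)%E,
                  ('V_P[entry_RV (z j) i] = 1)%E &
                  sub_gaussian sigma (entry_RV (z j) i)].

Definition estimator {m N : nat} (A : 'I_m -> 'M[R]_n) (Y : 'M[R]_n)
    (z : 'I_N -> {RV P >-> n.-tuple R}) (x : T) : 'cV[R]_m :=
  \col_i (N%:R^-1 *
    \sum_(j < N) ((Y *m vec_of (z j) x)^T *m A i *m (Y *m vec_of (z j) x)) 0 0).

End entries.
End probability_notions.

(* Main.v *)
(* Put B_i = Y A_i Y, so that Tr[A_i X A_i X] is the squared Frobenius norm of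
   B_i.  The quadratic form z^T B z - tr B splits as
   sum_i (B_ii (z_i^2 - 1) + 2 z_i g_i) with g_i = sum_(j < i) B_ij z_j.  Given
   the earlier coordinates, the exponential of the i-th term has mean at most
   exp (O(s^2) (B_ii^2 + g_i^2)), so the exponential of s times the form, divided
   by these compensators, is a supermartingale.  The compensators are
   controlled by convexity of exp, since each g_i is sub-Gaussian with variance
   proxy sigma^2 sum_(j < i) B_ij^2.  Hence
   E exp (u (z^T B z - tr B)) <= exp (D u^2 |B|_F^2) as soon as u |B|_F is small;
   only the Frobenius norm is needed because the sample size exceeds
   c log (m / delta).  Chernoff's bound on the N samples and a union bound over
   the m matrices conclude. *)
Require Import Defs.
From HB Require Import structures.
From mathcomp Require Import all_boot all_order all_algebra.
From mathcomp Require Import all_classical all_reals all_analysis.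
From mathcomp Require Import measurable_realfun ring lra.

Set Implicit Arguments.
Unset Strict Implicit.
Unset Printing Implicit Defensive.

Import Order.TTheory GRing.Theory Num.Theory.
Import numFieldNormedType.Exports.

Local Open Scope classical_set_scope.
Local Open Scope ring_scope.

(** * Independence and resampling *)

Section resampling.
Context {d : measure_display} {T : measurableType d} {R : realType}
  {P : probability T R} {d' : measure_display} {T' : measurableType d'}.
Variable n : nat.

Definition tuple_set (t : n.-tuple T') (k : 'I_n) (y : T') : n.-tuple T' :=
  [tuple if i == k then y else tnth t i | i < n].

Lemma tnth_tuple_set (t : n.-tuple T') k y i :
  tnth (tuple_set t k y) i = if i == k then y else tnth t i.
Proof. by rewrite tnth_mktuple. Qed.

Definition rectangle (B : 'I_n -> set T') : set (n.-tuple T') :=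
  \bigcap_(i in [set: 'I_n]) [set t | B i (tnth t i)].

Lemma measurable_rectangle (B : 'I_n -> set T') :
  (forall i, measurable (B i)) -> measurable (rectangle B).
Proof.
move=> mB; apply: fin_bigcap_measurable; first exact: finite_finset.
by move=> i _; rewrite -[X in measurable X]setTI; exact: measurable_tnth.
Qed.

(** A coordinate cylinder is a rectangle all of whose other sides are full. Rectangles, unlike
    cylinders, are stable under intersection, as uniqueness of measures requires of a generating
    family. *)
Lemma measurable_tuple_rectangle :
  @measurable _ (n.-tuple T') =
  <<s [set rectangle B | B in [set B | forall i, measurable (B i)]] >>.
Proof.
apply/seteqP; split.
- apply: smallest_sub; first exact: smallest_sigma_algebra.
  rewrite -bigcup_seq => A [i _ /= [B mB <-]].
  apply: sub_sigma_algebra; exists (fun j => if j == i then B else setT).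
    by move=> j; case: ifP.
  apply/seteqP; split => t /=.
    by move=> /(_ i I) /=; rewrite eqxx; split.
  by case=> _ Bt j _ /=; case: eqVneq => [->|].
- apply: smallest_sub; first exact: sigma_algebra_measurable.
  by move=> _ [B mB <-]; exact: measurable_rectangle.
Qed.

Variable X : 'I_n -> {RV P >-> T'}.

Definition joint (w : T) : n.-tuple T' := [tuple X i w | i < n].

Lemma measurable_joint : measurable_fun setT joint.
Proof.
apply/measurable_fun_tnthP => i.
rewrite (_ : _ \o _ = X i); first exact: measurable_funP.
by apply/funext => w /=; rewrite tnth_mktuple.
Qed.

(** The second component of [w] is an independent copy of the probability space, which supplies
    coordinate [k] only. *)
Definition resampled (k : 'I_n) (w : T * T) : n.-tuple T' :=
  tuple_set (joint w.1) k (X k w.2).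

Lemma measurable_resampled k : measurable_fun setT (resampled k).
Proof.
apply/measurable_fun_tnthP => i.
rewrite (_ : _ \o _ = fun w => if i == k then X k w.2 else X i w.1).
  by case: eqP => _; apply: measurableT_comp.
by apply/funext => w /=; rewrite !tnth_mktuple.
Qed.

Hypothesis Xind : mutually_independent X.

Lemma law_rectangle (B : 'I_n -> set T') : (forall i, measurable (B i)) ->
  P (joint @^-1` rectangle B) = (\prod_(i < n) P (X i @^-1` B i))%E.
Proof.
move=> mB; have := @Xind (finset.setTfor 'I_n) B (fun i _ => mB i).
rewrite (eq_bigl xpredT) => [<-|i]; last by rewrite inE.
congr (P _); apply/seteqP; split => w /= h i _; last first.
  by rewrite /= tnth_mktuple; apply: h; rewrite /= inE.
by have := h i I; rewrite /= tnth_mktuple.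
Qed.

(** The constraint on coordinate [k] moves to the second factor of the product space and leaves a
    full side behind; independence then factors both probabilities into the same product. *)
Lemma resampled_rectangle k (B : 'I_n -> set T') :
  (forall i, measurable (B i)) ->
  (P \x P)%E (resampled k @^-1` rectangle B) = P (joint @^-1` rectangle B).
Proof.
move=> mB; pose B' (i : 'I_n) := if i == k then setT else B i.
have -> : resampled k @^-1` rectangle B =
    (joint @^-1` rectangle B') `*` (X k @^-1` B k).
  apply/seteqP; split => -[w w'] /=.
    move=> h; split; last first.
      by have := h k I; rewrite /= tnth_mktuple eqxx.
    move=> i _; have := h i I; rewrite /B' /= !tnth_mktuple.
    by case: ifP.
  move=> [h hk] i _; rewrite /= tnth_mktuple; case: eqVneq => [->//|ik].
  by have := h i I; rewrite /B' /= (negbTE ik).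
have mB' i : measurable (B' i) by rewrite /B'; case: ifP.
have mJ : measurable (joint @^-1` rectangle B').
  rewrite -[X in measurable X]setTI; apply: measurable_joint => //.
  exact: measurable_rectangle.
have mX : measurable (X k @^-1` B k).
  by rewrite -[X in measurable X]setTI; exact: (measurable_funP (X k)).
transitivity (P (joint @^-1` rectangle B') * P (X k @^-1` B k))%E.
  exact: product_measure1E.
rewrite (law_rectangle mB) (law_rectangle mB').
rewrite (bigD1 k)//= [in RHS](bigD1 k)//= {1}/B' eqxx.
rewrite preimage_setT probability_setT mul1e muleC; congr (_ * _)%E.
by apply: eq_bigr => i ik; rewrite /B' (negbTE ik).
Qed.

(** The laws of [joint] and [resampled k] agree on rectangles, hence everywhere, and Tonelli
    separates the two sources of randomness. This stands in for conditioning on all coordinates but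
    [k]. *)
Lemma integral_resampled k (f : n.-tuple T' -> \bar R) :
  measurable_fun [set: n.-tuple T'] f -> (forall t, 0 <= f t)%E ->
  (\int[P]_w f (joint w) =
   \int[P]_w \int[P]_w' f (tuple_set (joint w) k (X k w')))%E.
Proof.
move=> mf f0.
transitivity (\int[P \x P]_w f (resampled k w))%E; last first.
  rewrite (@fubini_tonelli1 _ _ _ _ _ _ _ (f \o resampled k))//.
    exact: measurableT_comp mf (measurable_resampled k).
  by move=> w; exact: f0.
transitivity (\int[pushforward P joint]_t f t)%E.
  by rewrite (ge0_integral_pushforward measurable_joint).
transitivity (\int[pushforward (P \x P)%E (resampled k)]_t f t)%E; last first.
  by rewrite (ge0_integral_pushforward (measurable_resampled k)).
apply: eq_measure_integral; [exact: measurable_resampled|exact: measurable_joint|].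
move=> mr mj A mA _.
apply: (measure_unique _ (fun=> setT) measurable_tuple_rectangle) => //.
- move=> _ _ [B mB <-] [C mC <-]; exists (fun i => B i `&` C i).
    by move=> i; exact: measurableI.
  apply/seteqP; split => t.
    by move=> h; split => i _; have [] := h i I.
  by move=> [h h'] i _; split; [exact: h|exact: h'].
- by move=> _; exists (fun=> setT) => //; apply/seteqP; split.
- by apply/seteqP; split => // t _; exists 0%N.
- move=> _ [B mB <-]; rewrite /= /pushforward.
  by rewrite resampled_rectangle.
- move=> _; rewrite /= /pushforward (preimage_setT joint).
  by rewrite probability_setT ltry.
Qed.

End resampling.

(** * Products of adapted factors *)

Section adapted_product.
Context {d : measure_display} {T : measurableType d} {R : realType}
  {P : probability T R} {d' : measure_display} {T' : measurableType d'}.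
Variables (n : nat) (X : 'I_n -> {RV P >-> T'}).
Hypothesis Xind : mutually_independent X.

(* Peeling off the last factor: given the coordinates before [k], the [k]-th
   one can be integrated out first. *)
Lemma integral_adapted_prod (f : 'I_n -> n.-tuple T' -> R) (c : 'I_n -> R) :
  (forall i, measurable_fun [set: n.-tuple T'] (f i)) ->
  (forall i t, 0 <= f i t) -> (forall i, 0 <= c i) ->
  (forall (i k : 'I_n) t y, (i < k)%N -> f i (tuple_set t k y) = f i t) ->
  (forall i t, (\int[P]_w (f i (tuple_set t i (X i w)))%:E <= (c i)%:E)%E) ->
  (\int[P]_w (\prod_i f i (joint X w))%:E <= (\prod_i c i)%:E)%E.
Proof.
move=> mf f0 c0 fadapt fc.
suff main m : (m <= n)%N ->
    (\int[P]_w (\prod_(i < n | (i < m)%N) f i (joint X w))%:E <=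
     (\prod_(i < n | (i < m)%N) c i)%:E)%E.
  have := main n (leqnn n).
  by under eq_integral do under eq_bigl do rewrite ltn_ord;
    under [in leRHS]eq_bigl do rewrite ltn_ord.
elim: m => [_|m IH mn].
  under eq_integral do rewrite big_pred0//.
  rewrite big_pred0// integral_cst//.
  by rewrite [X in (_ * X)%E]probability_setT mule1.
pose k := Ordinal mn.
have split_k (F : 'I_n -> R) : \prod_(i < n | (i < m.+1)%N) F i =
    F k * \prod_(i < n | (i < m)%N) F i.
  rewrite (bigD1 k)//=; congr (_ * _); apply: eq_bigl => i.
  by rewrite -val_eqE /= ltnS; case: ltngtP.
pose g t := \prod_(i < n | (i < m)%N) f i t.
have mg : measurable_fun [set: n.-tuple T'] g.
  rewrite (_ : g = fun t => \prod_(i < n) if (i < m)%N then f i t else 1).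
    by apply: measurable_prod => i _; case: (i < m)%N.
  by apply/funext => t; rewrite /g [LHS]big_mkcond.
have g0 t : 0 <= g t by exact: prodr_ge0.
have mgJ : measurable_fun setT (fun w => (g (joint X w))%:E).
  by apply/measurable_EFinP; exact: measurableT_comp (measurable_joint X).
under eq_integral do rewrite split_k.
rewrite (integral_resampled Xind k (f := fun t => (f k t * g t)%:E)); first last.
- by move=> t; rewrite lee_fin mulr_ge0.
- by apply/measurable_EFinP; exact: measurable_funM.
have gk t y : g (tuple_set t k y) = g t.
  by rewrite /g; apply: eq_bigr => i im; rewrite fadapt.
have mfk t : measurable_fun setT (fun w => (f k (tuple_set t k (X k w)))%:E).
  apply/measurable_EFinP; apply: measurableT_comp => //.
  apply/measurable_fun_tnthP => i.
  rewrite (_ : _ \o _ = fun w => if i == k then X k w else tnth t i).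
    by case: eqP => _.
  by apply/funext => w /=; rewrite tnth_tuple_set.
apply: (@le_trans _ _ (\int[P]_w ((c k)%:E * (g (joint X w))%:E))%E).
  apply: ge0_le_integral => //.
  - by move=> w _; apply: integral_ge0 => w' _; rewrite lee_fin mulr_ge0.
  - apply: (@measurable_fun_fubini_tonelli_F _ _ _ _ _ P
      (fun w => (f k (resampled X k w) * g (resampled X k w))%:E)).
      apply/measurable_EFinP; apply: measurable_funM;
        exact: measurableT_comp (measurable_resampled X k).
    by move=> w; rewrite lee_fin mulr_ge0.
  - exact: measurable_funeM.
  - move=> w _; under eq_integral do rewrite gk EFinM.
    rewrite ge0_integralZr ?lee_fin//; last by move=> w' _; rewrite lee_fin.
    by rewrite lee_wpmul2r// lee_fin.
rewrite ge0_integralZl//; first last.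
- by rewrite lee_fin.
- by move=> w _; rewrite lee_fin.
by rewrite split_k EFinM lee_wpmul2l ?lee_fin// IH// ltnW.
Qed.

End adapted_product.

(** * Exponential inequalities *)

Section real_inequalities.
Context {R : realType}.
Implicit Types x y : R.

Lemma expR_le_quadratic y : expR y <= 1 + y + y ^+ 2 * expR `|y|.
Proof.
have e0 := expR_gt0 y; have eN0 := expR_gt0 (- y).
have ee : expR y * expR (- y) = 1 by rewrite -expRD subrr expR0.
have hN := expR_ge1Dx (- y); have h := expR_ge1Dx y.
case: (leP 0 y) => [y0|y0].
  rewrite ger0_norm//.
  have : expR y - 1 <= y * expR y by nra.
  by nra.
rewrite ltr0_norm//.
have : 1 <= expR (- y) by rewrite -expR0 ler_expR; lra.
have : expR y - 1 <= y * expR y by nra.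
by nra.
Qed.

Lemma expR1_le4 : expR 1 <= 4 :> R.
Proof.
have -> : 1 = 2^-1 + 2^-1 :> R by lra.
rewrite expRD; have ee : expR (2^-1) * expR (- 2^-1) = 1 :> R.
  by rewrite -expRD subrr expR0.
have := expR_ge1Dx (- 2^-1 : R); have := expR_gt0 (2^-1 : R).
have : 0 < expR (- 2^-1 : R) by exact: expR_gt0.
nra.
Qed.

Lemma sqr_le_expR y : 0 <= y -> y ^+ 2 <= 2 * expR y.
Proof.
move=> y0; have := expR_ge1Dxn 1 y0.
by rewrite (_ : 2`!%:R = 2)//; have := expR_gt0 y; nra.
Qed.

(** Keep a single term of the exponential series at the absolute value of [y]; the symmetric right
    side absorbs the sign. *)
Lemma pow_even_le_expR y k : y ^+ (2 * k) <= (2 * k)`!%:R * (expR y + expR (- y)).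
Proof.
wlog y0 : y / 0 <= y => [hw|].
  case: (leP 0 y) => [|/ltW]; first exact: hw.
  rewrite -oppr_ge0 => /hw; rewrite opprK exprM sqrrN -exprM.
  by rewrite [expR (- y) + _]addrC.
have f0 : 0 < (2 * k)`!%:R :> R by rewrite ltr0n fact_gt0.
rewrite -ler_pdivrMl// mulrC.
have := expR_gt0 (- y).
case: k f0 => [|k] f0.
  by rewrite muln0 expr0 fact0 divr1 => _; have := expR_ge1Dx y;
    have := expR_gt0 (-y); nra.
have := expR_ge1Dxn (2 * k.+1).-1 y0.
rewrite prednK ?muln_gt0//; lra.
Qed.

(** The quotient of the factorials has [k] factors, each at most [2 * k]. This lets the factorial of
    a moment bound cancel against that of the exponential series. *)
Lemma fact_double_le k : ((2 * k)`! <= k`! * (2 * k) ^ k)%N.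
Proof.
suff h j : ((k + j)`! <= k`! * (k + j) ^ j)%N by rewrite mul2n -addnn h.
elim: j => [|j IH]; first by rewrite addn0 expn0 muln1.
rewrite addnS factS expnS mulnCA leq_mul2l (leq_trans IH) ?orbT//.
rewrite leq_mul2l; case: j {IH} => [|j]; first by rewrite orbT.
by rewrite leq_exp2r// leqnSn orbT.
Qed.

(** Jensen's inequality with the missing weight placed at the point 0. The proof adds the tangent
    line inequalities at the mean [M], taken at each [y i] and at 0. *)
Lemma expR_combination (I : finType) (w y : I -> R) :
  (forall i, 0 <= w i) -> \sum_i w i <= 1 ->
  expR (\sum_i w i * y i) <= 1 - \sum_i w i + \sum_i w i * expR (y i).
Proof.
move=> w0 w1; set M := \sum_i w i * y i.
have h i : w i * (expR M * (1 + y i - M)) <= w i * expR (y i).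
  rewrite ler_wpM2l// (_ : y i = M + (y i - M)); last by ring.
  rewrite expRD ler_pM2l ?expR_gt0// (le_trans _ (expR_ge1Dx _))//.
  by rewrite le_eqVlt; apply/orP; left; apply/eqP; ring.
have : \sum_i w i * (expR M * (1 + y i - M)) <= \sum_i w i * expR (y i).
  by apply: ler_sum => i _; exact: h.
rewrite (_ : \sum_i w i * (expR M * (1 + y i - M)) =
    expR M * ((1 - M) * (\sum_i w i) + M)); last first.
  rewrite /M mulrDr !mulr_sumr -!big_split/=; apply: eq_bigr => i _.
  by rewrite -/M; ring.
have : expR M * (1 - M) <= 1.
  rewrite -[leRHS](expRxMexpNx_1 M) ler_pM2l ?expR_gt0//.
  by have := expR_ge1Dx (- M); lra.
move: w1; set S := \sum_i w i; move=> S1 hM.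
have S0 : 0 <= 1 - S by rewrite subr_ge0.
by have := ler_wpM2l S0 hM; lra.
Qed.

(** AM-GM for the exponentials of [x - p] and [y - q]. Once integrated it does the work of
    Cauchy-Schwarz, the shifts being chosen to normalise the two factors. *)
Lemma expR_half_sum x y p q :
  expR ((x + y) / 2) <=
  expR ((p + q) / 2) * (2^-1 * (expR (x - p) + expR (y - q))).
Proof.
have -> : (x + y) / 2 = (p + q) / 2 + ((x - p) / 2 + (y - q) / 2) by field.
rewrite [leLHS]expRD ler_pM2l ?expR_gt0// [leLHS]expRD.
have h (z : R) : expR z = expR (z / 2) ^+ 2 by rewrite -expRM_natl; congr expR; field.
rewrite (h (x - p)) (h (y - q)).
by have := sqr_ge0 (expR ((x - p) / 2) - expR ((y - q) / 2)); nra.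
Qed.

End real_inequalities.

Lemma expR_nneseries {R : realType} (x : R) :
  (expR x)%:E = (\sum_(k <oo) (x ^+ k / k`!%:R)%:E)%E.
Proof.
have -> : (\sum_(k <oo) (x ^+ k / k`!%:R)%:E)%E =
    limn (EFin \o series (exp_coeff x)).
  apply/congr_lim/funext => n /=; rewrite sumEFin; congr (_ %:E).
by rewrite EFin_lim//; exact: is_cvg_series_exp_coeff.
Qed.

Lemma nneseries_geometric_le {R : realType} (q : R) : 0 <= q -> 2 * q <= 1 ->
  (\sum_(k <oo) (if k == 0 then 1 else 2 * q ^+ k)%:E <= (1 + 4 * q)%:E)%E.
Proof.
move=> q0 q1; apply: lime_le.
  apply: is_cvg_nneseries => k _ _; rewrite lee_fin.
  by case: eqP => // _; rewrite mulr_ge0// exprn_ge0.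
apply: nearW => n; rewrite sumEFin lee_fin.
case: n => [|n]; first by rewrite big_geq//; lra.
(* The subtracted term makes the induction close, because [2 * q <= 1] gives
   [4 * q ^+ n.+2 <= 2 * q ^+ n.+1]. *)
suff : \sum_(0 <= k < n.+1) (if k == 0 then 1 else 2 * q ^+ k) <=
    1 + 4 * q - 4 * q ^+ n.+1.
  by have := exprn_ge0 n.+1 q0; lra.
elim: n => [|n IH]; first by rewrite big_nat1 eqxx; lra.
rewrite big_nat_recr//=; have := exprn_ge0 n.+1 q0.
by rewrite [q ^+ n.+2]exprS; nra.
Qed.

(** * Exponential moments of the square of a sub-Gaussian variable *)

Section sub_gaussian_moments.
Context {d : measure_display} {T : measurableType d} {R : realType}
  {P : probability T R}.

Lemma integral_cst1 (r : R) : (\int[P]_w r%:E = r%:E)%E.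
Proof.
by rewrite integral_cst// [X in (_ * X)%E]probability_setT mule1.
Qed.

(* Expand the exponential and bound the [k]-th moment of [h^2] by the moment
   generating function of [h] at the optimal point [sqrt (2k/v)]. *)
Lemma integral_expR_sqr_le (v eta : R) (h : T -> R) :
  0 < v -> 0 <= eta -> 8 * (eta * v) <= 1 -> measurable_fun setT h ->
  (forall t, \int[P]_w (expR (t * h w))%:E <= (expR (v * t ^+ 2 / 2))%:E)%E ->
  (\int[P]_w (expR (eta * h w ^+ 2))%:E <= (expR (16 * (eta * v)))%:E)%E.
Proof.
move=> v0 eta0 eta1 mh hv; set q := 4 * (eta * v).
have ev0 : 0 <= eta * v by rewrite mulr_ge0// ltW.
have mpow k : measurable_fun setT (fun w => (eta * h w ^+ 2) ^+ k / k`!%:R).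
  by apply: measurable_funM => //; apply: measurable_funX;
    apply: measurable_funM => //; exact: measurable_funX.
have pow0 k w : 0 <= (eta * h w ^+ 2) ^+ k / k`!%:R.
  by rewrite divr_ge0// exprn_ge0// mulr_ge0// sqr_ge0.
under eq_integral do rewrite expR_nneseries.
rewrite integral_nneseries//; last 2 first.
- by move=> k; exact/measurable_EFinP.
- by move=> k w _; rewrite lee_fin.
apply: (@le_trans _ _ (1 + 4 * q)%:E); last first.
  by rewrite lee_fin (le_trans _ (expR_ge1Dx _))// /q; lra.
apply: le_trans (nneseries_geometric_le (q := q) _ _); last 2 first.
- by rewrite /q; lra.
- by rewrite /q; lra.
apply: lee_nneseries => [k _ _|k _].
  by apply: integral_ge0 => w _; rewrite lee_fin.
case: k => [|k] /=.
  under eq_integral do rewrite expr0 fact0 divr1.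
  by rewrite integral_cst1.
set n := k.+1; pose t := Num.sqrt (2 * n%:R / v).
have n0 : 0 < n%:R :> R by rewrite ltr0n.
have t2 : t ^+ 2 = 2 * n%:R / v.
  by rewrite sqr_sqrtr// divr_ge0// ?mulr_ge0// ltW.
have pointwise w : (eta * h w ^+ 2) ^+ n / n`!%:R <=
    (eta * v) ^+ n * (expR (t * h w) + expR (- t * h w)).
  have hh : (2 * n%:R / v) ^+ n * (h w ^+ 2) ^+ n <=
      (2 * n)`!%:R * (expR (t * h w) + expR (- t * h w)).
    by rewrite -t2 -exprMn -exprMn -exprM mulNr pow_even_le_expR.
  have fd : (2 * n)`!%:R <= n`!%:R * (2 * n%:R) ^+ n :> R.
    by rewrite -natrM -natrX -natrM ler_nat fact_double_le.
  have fn0 : 0 < n`!%:R :> R by rewrite ltr0n fact_gt0.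
  have n2 : 0 < (2 * n%:R) ^+ n :> R by rewrite exprn_gt0// mulr_gt0.
  have vn : 0 < v ^+ n by rewrite exprn_gt0.
  set S := expR (t * h w) + expR (- t * h w) in hh *.
  have S0 : 0 <= S by rewrite addr_ge0// expR_ge0.
  rewrite ler_pdivrMr// [(eta * _) ^+ n]exprMn [(eta * _) ^+ n]exprMn -mulrA -mulrA ler_wpM2l ?exprn_ge0//.
  rewrite -(ler_pM2l n2); move: hh; rewrite expr_div_n => hh.
  have {}hh : (2 * n%:R) ^+ n * (h w ^+ 2) ^+ n <= v ^+ n * ((2 * n)`!%:R * S).
    by rewrite -ler_pdivrMl// mulrA [_^-1 * _]mulrC.
  apply: (le_trans hh); rewrite [leRHS]mulrCA ler_pM2l//.
  rewrite (_ : _ * (S * _) = n`!%:R * (2 * n%:R) ^+ n * S); last by ring.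
  by rewrite ler_wpM2r.
have mexp s : measurable_fun setT (fun w => (expR (s * h w))%:E).
  apply/measurable_EFinP; apply: measurableT_comp => //.
  exact: measurable_funM.
apply: (@le_trans _ _ (\int[P]_w
    (((eta * v) ^+ n)%:E * ((expR (t * h w))%:E + (expR (- t * h w))%:E)))%E).
  apply: ge0_le_integral => //.
  - by move=> w _; rewrite lee_fin.
  - exact/measurable_EFinP.
  - by apply: measurable_funeM; exact: emeasurable_funD.
  - by move=> w _; rewrite -EFinD -EFinM lee_fin.
rewrite ge0_integralZl//; last 3 first.
- exact: emeasurable_funD.
- by move=> w _; rewrite -EFinD lee_fin addr_ge0// expR_ge0.
- by rewrite lee_fin exprn_ge0.
rewrite ge0_integralD//.
(* At this [t] the exponent [v * t ^+ 2 / 2] equals [n], so the [n]-th term is at most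
   [2 * (eta * v * expR 1) ^+ n]; with [expR 1 <= 4] this is at most [2 * q ^+ n]. *)
apply: (@le_trans _ _ (((eta * v) ^+ n)%:E *
    ((expR 1 ^+ n)%:E + (expR 1 ^+ n)%:E))%E).
  rewrite lee_wpmul2l ?lee_fin ?exprn_ge0//.
  have vt : v * t ^+ 2 / 2 = n%:R * 1 by rewrite t2; field; rewrite gt_eqF.
  by rewrite leeD// -expRM_natl -vt; [exact: hv|rewrite -(sqrrN t); exact: hv].
rewrite -EFinD -EFinM lee_fin -mulr2n -[_ *+ 2]mulr_natl mulrCA ler_pM2l//.
rewrite -exprMn lerXn2r ?nnegrE//.
- by rewrite mulr_ge0// expR_ge0.
- by rewrite /q; lra.
- by rewrite /q [leRHS]mulrC ler_wpM2l// expR1_le4.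
Qed.

End sub_gaussian_moments.

(** * Centered squares and one step of the supermartingale *)

Section sub_exponential.
Context {d : measure_display} {T : measurableType d} {R : realType}
  {P : probability T R}.
Variables (v : R) (X : T -> R).
Hypotheses (v0 : 0 < v) (mX : measurable_fun setT X).
Hypothesis Xv :
  forall t, (\int[P]_w (expR (t * X w))%:E <= (expR (v * t ^+ 2 / 2))%:E)%E.
Hypothesis X2 : (\int[P]_w (X w ^+ 2)%:E = 1)%E.

(** With [a = (8 * v)^-1], this is [8 / a ^+ 2 * expR a], the constant of the pointwise remainder
    bound, times [expR 2], the bound on the mean of [expR (a * X ^+ 2)]. *)
Definition sqr_proxy : R := 512 * v ^+ 2 * expR ((8 * v)^-1 + 2).

Lemma sqr_proxy_gt0 : 0 < sqr_proxy.
Proof. by rewrite !mulr_gt0// ?exprn_gt0// expR_gt0. Qed.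

(** Expand to second order: the linear term has mean zero because the second moment is 1, and the
    remainder is at most [u ^+ 2] times a multiple of [expR (a * X ^+ 2)]. The value
    [a = (8 * v)^-1] is the largest exponent that [integral_expR_sqr_le] admits. *)
Lemma integral_expR_centered_sqr_le (u : R) : `|u| * (16 * v) <= 1 ->
  (\int[P]_w (expR (u * (X w ^+ 2 - 1)))%:E <= (expR (sqr_proxy * u ^+ 2))%:E)%E.
Proof.
move=> hu; set a : R := (8 * v)^-1.
have a0 : 0 < a by rewrite invr_gt0 mulr_gt0.
have av : a * (8 * v) = 1 by rewrite mulVf// gt_eqF// mulr_gt0.
have ua : `|u| <= a / 2 by nra.
pose c : R := 8 / a ^+ 2 * expR a.
have c0 : 0 <= c by rewrite mulr_ge0 ?expR_ge0// divr_ge0// sqr_ge0.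
(* Splitting [u] as [al - be] allows the terms with a negative sign to be moved across the
   inequality, so that only nonnegative functions are integrated; the added mean [al + be] then
   cancels. *)
pose al := Num.max u 0; pose be := Num.max (- u) 0.
have al0 : 0 <= al by rewrite le_max lexx orbT.
have be0 : 0 <= be by rewrite le_max lexx orbT.
have uE : u = al - be.
  by rewrite /al /be; case: (leP u 0) => h1; case: (leP (- u) 0) => h2; lra.
have pw w : expR (u * (X w ^+ 2 - 1)) + (al + be * X w ^+ 2) <=
    1 + be + (al * X w ^+ 2 + u ^+ 2 * c * expR (a * X w ^+ 2)).
  set x := X w ^+ 2; have x0 : 0 <= x by exact: sqr_ge0.
  set y := `|x - 1|; have y0 : 0 <= y by exact: normr_ge0.
  have yx : y <= x + 1 by rewrite /y ler_norml; apply/andP; split; lra.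
  have h1 := expR_le_quadratic (u * (x - 1)).
  (* Half of the exponent [a * y] absorbs [y ^+ 2], the other half dominates [expR (|u| * y)] since
     [|u| <= a / 2]; then [y <= x + 1] yields the factor [expR a]. *)
  have h2 : (u * (x - 1)) ^+ 2 * expR `|u * (x - 1)| <=
      u ^+ 2 * c * expR (a * x).
    rewrite exprMn -[X in _ <= X]mulrA -mulrA ler_wpM2l ?sqr_ge0//.
    rewrite normrM -(real_normK (num_real (x - 1))) -/y.
    have a20 : 0 <= a / 2 by lra.
    have h3 := sqr_le_expR (mulr_ge0 a20 y0).
    have h4 : y ^+ 2 <= 8 / a ^+ 2 * expR (a / 2 * y).
      rewrite mulrAC ler_pdivlMr ?exprn_gt0//.
      by move: h3; rewrite !exprMn exprVn; lra.
    apply: (@le_trans _ _ (8 / a ^+ 2 * expR (a / 2 * y) * expR (a / 2 * y))).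
      rewrite ler_pM ?sqr_ge0 ?expR_ge0// ler_expR.
      exact: ler_wpM2r.
    rewrite /c -!mulrA !ler_wpM2l ?invr_ge0 ?sqr_ge0// -!expRD ler_expR.
    by nra.
  have h3 : u * (x - 1) = (al - be) * (x - 1) by rewrite -uE.
  by lra.
have mX2 : measurable_fun setT (fun w => X w ^+ 2) by exact: measurable_funX.
have me s : measurable_fun setT (fun w => expR (s * X w ^+ 2)).
  by apply: measurableT_comp => //; exact: measurable_funM.
have mu : measurable_fun setT (fun w => expR (u * (X w ^+ 2 - 1))).
  apply: measurableT_comp => //; apply: measurable_funM => //.
  exact: measurable_funB.
have int_lin (p q : R) (f : T -> R) : 0 <= p -> 0 <= q ->
    measurable_fun setT f -> (forall w, 0 <= f w) ->
    (\int[P]_w (f w + (p + q * X w ^+ 2))%:E = \int[P]_w (f w)%:E + (p + q)%:E)%E.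
  move=> p0 q0 mf f0; under eq_integral do rewrite EFinD.
  rewrite ge0_integralD//; last 4 first.
  - by move=> w _; rewrite lee_fin.
  - exact/measurable_EFinP.
  - by move=> w _; rewrite lee_fin addr_ge0// mulr_ge0// sqr_ge0.
  - by apply/measurable_EFinP; apply: measurable_funD => //; exact: measurable_funM.
  congr (_ + _)%E; under eq_integral do rewrite EFinD.
  rewrite ge0_integralD//; last 2 first.
  - by move=> w _; rewrite lee_fin mulr_ge0// sqr_ge0.
  - by apply/measurable_EFinP; exact: measurable_funM.
  rewrite integral_cst1 EFinD; congr (_ + _)%E.
  under eq_integral do rewrite EFinM.
  rewrite ge0_integralZl ?lee_fin//.
  - by rewrite X2 mule1.
  - exact/measurable_EFinP.
  - by move=> w _; rewrite lee_fin sqr_ge0.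
rewrite -(leeD2rE (x := (al + be)%:E))//.
rewrite -(int_lin al be _ al0 be0 mu); last by move=> w; exact: expR_ge0.
apply: (@le_trans _ _ (\int[P]_w (u ^+ 2 * c * expR (a * X w ^+ 2) +
    (1 + be + al * X w ^+ 2))%:E)%E).
  apply: ge0_le_integral => //.
  - move=> w _; rewrite lee_fin addr_ge0 ?expR_ge0// addr_ge0// mulr_ge0//.
    exact: sqr_ge0.
  - apply/measurable_EFinP; apply: measurable_funD => //.
    by apply: measurable_funD => //; exact: measurable_funM.
  - apply/measurable_EFinP; apply: measurable_funD; first exact: measurable_funM.
    by apply: measurable_funD => //; exact: measurable_funM.
  - by move=> w _; rewrite lee_fin; have := pw w; lra.
have uc0 : 0 <= u ^+ 2 * c by rewrite mulr_ge0// sqr_ge0.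
rewrite int_lin ?addr_ge0//; last 2 first.
- exact: measurable_funM.
- by move=> w; rewrite mulr_ge0// expR_ge0.
under eq_integral do rewrite EFinM.
rewrite ge0_integralZl ?lee_fin//; last exact/measurable_EFinP.
apply: (@le_trans _ _ ((u ^+ 2 * c)%:E * (expR 2)%:E + (1 + be + al)%:E)%E).
  rewrite leeD2r// lee_wpmul2l ?lee_fin//.
  have -> : 2 = 16 * (a * v) :> R by lra.
  by apply: integral_expR_sqr_le => //; [exact: ltW|lra].
rewrite -!EFinM -!EFinD lee_fin.
have -> : u ^+ 2 * c * expR 2 = sqr_proxy * u ^+ 2.
  have a2 : 8 / a ^+ 2 = 512 * v ^+ 2 by rewrite /a; field; rewrite gt_eqF.
  by rewrite /sqr_proxy -/a (expRD a) /c a2; ring.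
by have := expR_ge1Dx (sqr_proxy * u ^+ 2); lra.
Qed.

(** Here [g] plays the lower form, frozen by the earlier coordinates. AM-GM separates the square
    from the linear part at the price of doubling [s], whence 32 in place of 16. The compensator is
    half the sum of the two resulting exponents [p] and [q]. *)
Lemma integral_expR_step_le (s b g : R) : `|s * b| * (32 * v) <= 1 ->
  (\int[P]_w (expR (s * (b * (X w ^+ 2 - 1) + 2 * X w * g) -
     (2 * sqr_proxy * s ^+ 2 * b ^+ 2 + 4 * v * s ^+ 2 * g ^+ 2)))%:E <= 1)%E.
Proof.
move=> hs; set p := 4 * sqr_proxy * s ^+ 2 * b ^+ 2.
set q := 8 * v * s ^+ 2 * g ^+ 2.
pose f1 w := expR (2 * s * b * (X w ^+ 2 - 1)).
pose f2 w := expR (4 * s * g * X w).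
have mf1 : measurable_fun setT f1.
  apply: measurableT_comp => //; apply: measurable_funM => //.
  by apply: measurable_funB => //; exact: measurable_funX.
have mf2 : measurable_fun setT f2.
  by apply: measurableT_comp => //; exact: measurable_funM.
have i1 : (\int[P]_w (f1 w)%:E <= (expR p)%:E)%E.
  rewrite (_ : p = sqr_proxy * (2 * s * b) ^+ 2); last by rewrite /p; ring.
  apply: integral_expR_centered_sqr_le; rewrite -mulrA normrM gtr0_norm//.
  by lra.
have i2 : (\int[P]_w (f2 w)%:E <= (expR q)%:E)%E.
  rewrite (_ : q = v * (4 * s * g) ^+ 2 / 2); last by rewrite /q; field.
  exact: Xv.
apply: (@le_trans _ _ (\int[P]_w ((2^-1 * expR (- p))%:E * (f1 w)%:E +
    (2^-1 * expR (- q))%:E * (f2 w)%:E))%E).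
  apply: ge0_le_integral => //.
  - apply/measurable_EFinP; apply: measurableT_comp => //.
    apply: measurable_funB => //; apply: measurable_funM => //.
    apply: measurable_funD; apply: measurable_funM => //.
      by apply: measurable_funB => //; exact: measurable_funX.
    exact: measurable_funM.
  - by apply: emeasurable_funD; apply: measurable_funeM; exact/measurable_EFinP.
  - move=> w _; rewrite -!EFinM -EFinD lee_fin.
    have := expR_half_sum (2 * s * b * (X w ^+ 2 - 1) - p) (4 * s * g * X w - q) 0 0.
    rewrite addr0 mul0r expR0 mul1r !subr0.
    rewrite (expRD _ (- p)) (expRD _ (- q)) -/(f1 w) -/(f2 w).
    rewrite (_ : (_ - p + _) / 2 = s * (b * (X w ^+ 2 - 1) + 2 * X w * g) -
     (2 * sqr_proxy * s ^+ 2 * b ^+ 2 + 4 * v * s ^+ 2 * g ^+ 2)); last first.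
      by rewrite /p /q; field.
    by lra.
have pos r : (0 <= (2^-1 * expR r)%:E :> \bar R)%E.
  by rewrite lee_fin mulr_ge0// expR_ge0.
rewrite ge0_integralD//; last 4 first.
- by move=> w _; rewrite mule_ge0// lee_fin expR_ge0.
- by apply: measurable_funeM; exact/measurable_EFinP.
- by move=> w _; rewrite mule_ge0// lee_fin expR_ge0.
- by apply: measurable_funeM; exact/measurable_EFinP.
rewrite ge0_integralZl//; last 2 first.
- exact/measurable_EFinP.
- by move=> w _; rewrite lee_fin expR_ge0.
rewrite ge0_integralZl//; last 2 first.
- exact/measurable_EFinP.
- by move=> w _; rewrite lee_fin expR_ge0.
apply: le_trans (leeD (lee_wpmul2l (pos _) i1) (lee_wpmul2l (pos _) i2)) _.
rewrite -!EFinM -EFinD lee_fin -!mulrA -!expRD !addNr expR0; lra.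
Qed.

End sub_exponential.

(** * Quadratic forms of independent variables *)

Section quadratic_chaos.
Context {d : measure_display} {T : measurableType d} {R : realType}
  {P : probability T R}.
Variables (n : nat) (B : 'M[R]_n).

Definition lower_form (i : 'I_n) (t : n.-tuple R) : R :=
  \sum_(j < n | (j < i)%N) B i j * tnth t j.

(* For symmetric [B] this is [t^T B t - tr B], ordered as a martingale. *)
Definition centered_form (t : n.-tuple R) : R :=
  \sum_(i < n) (B i i * (tnth t i ^+ 2 - 1) + 2 * tnth t i * lower_form i t).

Definition frobenius2 : R := \sum_(i < n) \sum_(j < n) B i j ^+ 2.

Lemma lower_formE i t :
  lower_form i t = \sum_(j < n) (if (j < i)%N then B i j else 0) * tnth t j.
Proof.
rewrite /lower_form [LHS]big_mkcond; apply: eq_bigr => j _.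
by case: ifP; rewrite ?mul0r.
Qed.

Lemma measurable_lower_form i : measurable_fun [set: n.-tuple R] (lower_form i).
Proof.
rewrite (_ : lower_form i = fun t =>
    \sum_(j < n) (if (j < i)%N then B i j else 0) * tnth t j).
  apply: measurable_sum => j; apply: measurable_funM => //.
  exact: measurable_tnth.
by apply/funext => t; exact: lower_formE.
Qed.

Lemma measurable_centered_form :
  measurable_fun [set: n.-tuple R] centered_form.
Proof.
apply: measurable_sum => i; have mi := @measurable_tnth _ R n i.
apply: measurable_funD; apply: measurable_funM => //.
- by apply: measurable_funB => //; exact: measurable_funX.
- exact: measurable_funM.
- exact: measurable_lower_form.
Qed.

Variables (X : 'I_n -> {RV P >-> R}) (v : R).
Hypotheses (v0 : 0 < v) (Xind : mutually_independent X).
Hypothesis Xv : forall i t,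
  (\int[P]_w (expR (t * X i w))%:E <= (expR (v * t ^+ 2 / 2))%:E)%E.
Hypothesis X2 : forall i, (\int[P]_w (X i w ^+ 2)%:E = 1)%E.

(** Variance proxies of independent summands add up. The bound 1, instead of exact normalisation,
    also covers a zero coefficient vector. *)
Lemma linear_form_sub_gaussian (c : 'I_n -> R) (s : R) :
  \sum_i c i ^+ 2 <= 1 ->
  (\int[P]_w (expR (s * \sum_i c i * tnth (joint X w) i))%:E <=
   (expR (v * s ^+ 2 / 2))%:E)%E.
Proof.
move=> c1.
apply: (@le_trans _ _ (\prod_i expR (v * (s * c i) ^+ 2 / 2))%:E); last first.
  rewrite -expR_sum lee_fin ler_expR.
  rewrite (_ : \sum_i _ = v * s ^+ 2 / 2 * \sum_i c i ^+ 2).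
    by rewrite ler_piMr// divr_ge0// mulr_ge0 ?sqr_ge0// ltW.
  by rewrite mulr_sumr; apply: eq_bigr => i _; field.
under eq_integral => w _.
  rewrite mulr_sumr expR_sum; under eq_bigr do rewrite mulrA; over.
apply: (integral_adapted_prod Xind
  (f := fun i t => expR (s * c i * tnth t i))) => [i|i t|i|i k t y ik|i t].
- apply: measurableT_comp => //; apply: measurable_funM => //.
  exact: measurable_tnth.
- exact: expR_ge0.
- exact: expR_ge0.
- by rewrite tnth_tuple_set ifN// -val_eqE /= ltn_eqF.
- by under eq_integral do rewrite tnth_tuple_set eqxx; exact: Xv.
Qed.

(** The lower forms are dependent, but convexity reduces the claim to single rows: the sum of their
    squares combines the [M * h i w ^+ 2], with [h i] the row form scaled to unit proxy, using
    weights [be i ^+ 2 / M] of total at most 1. *)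
Lemma integral_expR_lower_forms_le (M eta : R) :
  0 < M -> frobenius2 <= M -> 0 <= eta -> 8 * (eta * M * v) <= 1 ->
  (\int[P]_w (expR (eta * \sum_i lower_form i (joint X w) ^+ 2))%:E <=
   (expR (16 * (eta * M * v)))%:E)%E.
Proof.
move=> M0 FM eta0 eta1.
pose be (i : 'I_n) := Num.sqrt (\sum_(j < n | (j < i)%N) B i j ^+ 2).
have be2 i : be i ^+ 2 = \sum_(j < n | (j < i)%N) B i j ^+ 2.
  by rewrite sqr_sqrtr// sumr_ge0// => j _; exact: sqr_ge0.
pose c (i j : 'I_n) := if (j < i)%N then B i j / be i else 0.
pose h i w := \sum_j c i j * tnth (joint X w) j.
pose wt i := be i ^+ 2 / M.
have lowE i w : lower_form i (joint X w) = be i * h i w.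
  rewrite lower_formE /h mulr_sumr; apply: eq_bigr => j _.
  rewrite /c; case: ifP => [ji|_]; last by rewrite !mul0r mulr0.
  (* Division by zero returns 0, which is the correct value here: a vanishing [be i] forces the
     entries left of the diagonal in row [i] to vanish. *)
  rewrite mulrA; congr (_ * _); have [b0|b0] := eqVneq (be i) 0.
    have /eqP := be2 i; rewrite b0 expr0n eq_sym psumr_eq0; last first.
      by move=> l _; exact: sqr_ge0.
    move=> /allP/(_ j); rewrite mem_index_enum => /(_ isT)/implyP/(_ ji).
    by rewrite sqrf_eq0 => /eqP ->; rewrite mul0r.
  by rewrite mulrC divfK.
have c1 i : \sum_j c i j ^+ 2 <= 1.
  have -> : \sum_j c i j ^+ 2 = be i ^+ 2 / be i ^+ 2.
    rewrite {1}be2 mulr_suml [RHS]big_mkcond; apply: eq_bigr => j _.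
    by rewrite /c; case: ifP => _; rewrite ?expr0n ?expr_div_n.
  have [->|b0] := eqVneq (be i ^+ 2) 0; first by rewrite mul0r.
  by rewrite divff.
have wt0 i : 0 <= wt i by rewrite divr_ge0 ?sqr_ge0// ltW.
have wt1 : \sum_i wt i <= 1.
  rewrite -mulr_suml ler_pdivrMr// mul1r (le_trans _ FM)//.
  apply: ler_sum => i _; rewrite be2 [leLHS]big_mkcond.
  by apply: ler_sum => j _; case: ifP => _ //; exact: sqr_ge0.
have mh i : measurable_fun setT (h i).
  apply: measurable_sum => j; apply: measurable_funM => //.
  exact: measurableT_comp (measurable_tnth j) (measurable_joint X).
pose G i w := expR (eta * M * h i w ^+ 2).
have mG i : measurable_fun setT (fun w => (G i w)%:E).
  apply/measurable_EFinP; apply: measurableT_comp => //.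
  by apply: measurable_funM => //; exact: measurable_funX.
have iG i : (\int[P]_w (G i w)%:E <= (expR (16 * (eta * M * v)))%:E)%E.
  apply: integral_expR_sqr_le => //; first by rewrite mulr_ge0// ltW.
  by move=> s; exact: linear_form_sub_gaussian.
apply: (@le_trans _ _ (\int[P]_w ((1 - \sum_i wt i)%:E +
    \sum_i (wt i)%:E * (G i w)%:E))%E).
  apply: ge0_le_integral => //.
  - apply/measurable_EFinP; apply: measurableT_comp => //.
    apply: measurable_funM => //; apply: measurable_sum => i.
    apply: measurable_funX.
    exact: measurableT_comp (measurable_lower_form i) (measurable_joint X).
  - apply: emeasurable_funD => //; apply: emeasurable_sum => i.
    exact: measurable_funeM.
  - move=> w _; under [X in (_ + X)%E]eq_bigr do rewrite -EFinM.
    rewrite sumEFin -EFinD lee_fin.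
    rewrite (_ : eta * _ = \sum_i wt i * (eta * M * h i w ^+ 2)).
      exact: expR_combination.
    rewrite mulr_sumr; apply: eq_bigr => i _; rewrite lowE /wt.
    by field; rewrite gt_eqF.
rewrite ge0_integralD//; last 3 first.
- by move=> w _; rewrite lee_fin subr_ge0.
- by move=> w _; apply: sume_ge0 => i _; rewrite -EFinM lee_fin mulr_ge0// expR_ge0.
- by apply: emeasurable_sum => i; exact: measurable_funeM.
rewrite integral_cst1 ge0_integral_sum//; last 2 first.
- by move=> i; exact: measurable_funeM.
- by move=> i w _; rewrite -EFinM lee_fin mulr_ge0// expR_ge0.
set E := expR (16 * _) in iG *.
apply: (@le_trans _ _ ((1 - \sum_i wt i)%:E + \sum_i (wt i)%:E * E%:E)%E).
  rewrite leeD2l//; apply: lee_sum => i _.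
  rewrite ge0_integralZl ?lee_fin//.
    by rewrite lee_wpmul2l// lee_fin.
  by move=> w _; rewrite lee_fin expR_ge0.
rewrite (eq_bigr (fun i => (wt i * E)%:E))//.
rewrite sumEFin -EFinD lee_fin.
rewrite [X in _ + X](_ : _ = (\sum_i wt i) * E); last by rewrite mulr_suml.
(* The leftover weight [1 - S] carries the value 1, so [1 <= E] is what bounds the whole combination
   by [E]. *)
have E1 : 1 <= E.
  rewrite -expR0 ler_expR mulr_ge0// mulr_ge0 ?(ltW v0)//.
  by rewrite mulr_ge0// ltW.
move: E1 wt1; set S := \sum_i wt i => E1 wt1.
have : 0 <= (1 - S) * (E - 1) by rewrite mulr_ge0// subr_ge0.
by lra.
Qed.

(** Coefficient of [u ^+ 2 * M] in [Q / 2] below, at [s = 2 * u]: the first summand comes from the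
    diagonal of [B], the second from the lower forms. *)
Definition chaos_proxy : R := 4 * sqr_proxy v + 128 * v ^+ 2.

(* [e^(uW)] is the geometric mean of a supermartingale with compensator
   [2 q s^2 sum_i B_ii^2 + 4 v s^2 sum_i g_i^2] ([s = 2u]) and of the
   exponential of this compensator. *)
Lemma integral_expR_centered_form_le (M u : R) :
  0 < M -> frobenius2 <= M -> u ^+ 2 * M * (64 * v) ^+ 2 <= 1 ->
  (\int[P]_w (expR (u * centered_form (joint X w)))%:E <=
   (expR (chaos_proxy * u ^+ 2 * M))%:E)%E.
Proof.
move=> M0 FM hu; pose s := 2 * u; pose q := sqr_proxy v.
have q0 : 0 < q by exact: sqr_proxy_gt0.
pose comp i t := 2 * q * s ^+ 2 * B i i ^+ 2 +
  4 * v * s ^+ 2 * lower_form i t ^+ 2.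
pose Q := (2 * q + 64 * v ^+ 2) * s ^+ 2 * M.
have v20 : 0 <= v ^+ 2 by exact: sqr_ge0.
have uM0 : 0 <= u ^+ 2 * M by rewrite mulr_ge0 ?sqr_ge0// ltW.
have bM : \sum_i B i i ^+ 2 <= M.
  rewrite (le_trans _ FM)//; apply: ler_sum => i _.
  by rewrite (bigD1 i)//= lerDl sumr_ge0// => j _; exact: sqr_ge0.
have biM i : B i i ^+ 2 <= M.
  rewrite (le_trans _ bM)// (bigD1 i)//= lerDl sumr_ge0// => j _.
  exact: sqr_ge0.
pose step i t := expR (s * (B i i * (tnth t i ^+ 2 - 1) +
  2 * tnth t i * lower_form i t) - comp i t).
have mtnth i := @measurable_tnth _ R n i.
have mcomp i : measurable_fun [set: n.-tuple R] (comp i).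
  apply: measurable_funD => //; apply: measurable_funM => //.
  by apply: measurable_funX; exact: measurable_lower_form.
have mstep i : measurable_fun [set: n.-tuple R] (step i).
  apply: measurableT_comp => //; apply: measurable_funB => //.
  apply: measurable_funM => //.
  apply: measurable_funD; apply: measurable_funM => //.
  - by apply: measurable_funB => //; exact: measurable_funX.
  - exact: measurable_funM.
  - exact: measurable_lower_form.
(* Equality [i = k] is allowed because [lower_form i] reads only coordinates strictly before [i]; it
   stays frozen while coordinate [i] is integrated out. *)
have low_set (i k : 'I_n) t y : (i <= k)%N ->
    lower_form i (tuple_set t k y) = lower_form i t.
  move=> ik; apply: eq_bigr => j ji.
  by rewrite tnth_tuple_set ifN// -val_eqE /= ltn_eqF// (leq_trans ji).
pose e1 w := \prod_i step i (joint X w).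
pose e2 w := expR (\sum_i comp i (joint X w)).
have ie1 : (\int[P]_w (e1 w)%:E <= 1)%E.
  have -> : 1%E = (\prod_(i < n) 1 : R)%:E by rewrite big1.
  apply: (integral_adapted_prod Xind (f := step)) => // [i t|i k t y ik|i t].
  - exact: expR_ge0.
  - rewrite /step /comp low_set; last exact: ltnW.
    by rewrite tnth_tuple_set ifN// -val_eqE /= ltn_eqF.
  - under eq_integral do
      rewrite /step /comp low_set// tnth_tuple_set eqxx.
    (* After squaring, [B i i ^+ 2 <= M] and [s = 2 * u] turn the step condition with 32 into the
       hypothesis with 64. *)
    apply: integral_expR_step_le => //.
    rewrite -(@ler_pXn2r _ 2)// ?nnegrE ?mulr_ge0 ?(ltW v0)//.
    rewrite exprMn real_normK ?num_real// expr1n (le_trans _ hu)//.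
    rewrite /s !exprMn.
    have := biM i; have := sqr_ge0 u; have := sqr_ge0 v.
    move: (u ^+ 2) (v ^+ 2) (B i i ^+ 2) => u2 v2 b2 hv hu2 hb.
    by have := ler_wpM2l (mulr_ge0 hu2 hv) hb; nra.
have ie2 : (\int[P]_w (e2 w)%:E <= (expR Q)%:E)%E.
  have e2E w : e2 w = expR (2 * q * s ^+ 2 * \sum_i B i i ^+ 2) *
      expR (4 * v * s ^+ 2 * \sum_i lower_form i (joint X w) ^+ 2).
    by rewrite -expRD /e2 big_split/= -!mulr_sumr.
  under eq_integral do rewrite e2E EFinM.
  have s20 : 0 <= s ^+ 2 by exact: sqr_ge0.
  rewrite ge0_integralZl ?lee_fin ?expR_ge0//; last first.
    apply/measurable_EFinP; apply: measurableT_comp => //.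
    apply: measurable_funM => //; apply: measurable_sum => i.
    apply: measurable_funX.
    exact: measurableT_comp (measurable_lower_form i) (measurable_joint X).
  have vs0 : 0 <= 4 * v * s ^+ 2 by rewrite mulr_ge0// mulr_ge0// ltW.
  have := integral_expR_lower_forms_le M0 FM vs0.
  have hs : 8 * (4 * v * s ^+ 2 * M * v) <= 1.
    rewrite (le_trans _ hu)// /s !exprMn.
    by have := mulr_ge0 uM0 v20; nra.
  move=> /(_ hs) ilow.
  apply: (@le_trans _ _ ((expR (2 * q * s ^+ 2 * M))%:E *
      (expR (16 * (4 * v * s ^+ 2 * M * v)))%:E)%E).
    apply: lee_pmul => //.
    - by apply: integral_ge0 => w _; rewrite lee_fin expR_ge0.
    - rewrite lee_fin ler_expR ler_wpM2l// mulr_ge0// mulr_ge0// ltW//.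
  rewrite -EFinM -expRD lee_fin ler_expR /Q le_eqVlt; apply/orP; left.
  by apply/eqP; ring.
have mJ (f : n.-tuple R -> R) : measurable_fun [set: n.-tuple R] f ->
    measurable_fun setT (fun w => f (joint X w)).
  by move=> mf; exact: measurableT_comp mf (measurable_joint X).
have me1 : measurable_fun setT (fun w => (e1 w)%:E).
  by apply/measurable_EFinP; apply: measurable_prod => i _; exact: mJ.
have me2 : measurable_fun setT (fun w => (e2 w)%:E).
  apply/measurable_EFinP; apply: measurableT_comp => //.
  by apply: measurable_sum => i; exact: mJ.
have e10 w : 0 <= e1 w by apply: prodr_ge0 => i _; exact: expR_ge0.
(* These are the weights of [expR_half_sum] with shifts 0 and [Q]: [e1] has mean at most 1 already,
   and [expR (- Q)] brings [e2] to the same bound. *)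
pose k := expR (Q / 2) / 2.
have k0 : 0 <= k by rewrite divr_ge0// expR_ge0.
have kQ0 : 0 <= k * expR (- Q) by rewrite mulr_ge0// expR_ge0.
apply: (@le_trans _ _ (\int[P]_w (k%:E * (e1 w)%:E +
    (k * expR (- Q))%:E * (e2 w)%:E))%E).
  apply: ge0_le_integral => //.
  - apply/measurable_EFinP; apply: measurableT_comp => //.
    by apply: measurable_funM => //; apply: mJ; exact: measurable_centered_form.
  - by apply: emeasurable_funD; exact: measurable_funeM.
  - move=> w _; rewrite -!EFinM -EFinD lee_fin.
    pose Y := \sum_i comp i (joint X w).
    have e1E : e1 w = expR (s * centered_form (joint X w) - Y).
      by rewrite /e1 -expR_sum /centered_form mulr_sumr -sumrB.
    have := expR_half_sum (s * centered_form (joint X w) - Y) Y 0 Q.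
    rewrite subr0 add0r subrK (_ : s * _ / 2 = u * centered_form (joint X w));
      last by rewrite /s; field.
    rewrite (expRD Y) -e1E -/(e2 w) -/Y.
    by rewrite /k; set a := expR (Q / 2); set b := expR (- Q); nra.
rewrite ge0_integralD//; last 4 first.
- by move=> w _; rewrite -EFinM lee_fin mulr_ge0.
- exact: measurable_funeM.
- by move=> w _; rewrite -EFinM lee_fin mulr_ge0// expR_ge0.
- exact: measurable_funeM.
rewrite ge0_integralZl ?lee_fin//; last by move=> w _; rewrite lee_fin.
rewrite [X in (_ + X)%E]ge0_integralZl ?lee_fin//; last first.
  by move=> w _; rewrite lee_fin expR_ge0.
apply: (@le_trans _ _ (k%:E * 1 + (k * expR (- Q))%:E * (expR Q)%:E)%E).
  by apply: leeD; apply: lee_wpmul2l; rewrite ?lee_fin.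
rewrite mule1 -EFinM -EFinD lee_fin.
have -> : k * expR (- Q) * expR Q = k.
  by rewrite -mulrA (mulrC (expR (- Q))) expRxMexpNx_1 mulr1.
rewrite /k.
rewrite -splitr (_ : Q / 2 = chaos_proxy * u ^+ 2 * M)//.
by rewrite /Q /chaos_proxy -/q /s; field.
Qed.

End quadratic_chaos.

(** * Tail bounds *)

Section deviation.
Context {d : measure_display} {T : measurableType d} {R : realType}
  {P : probability T R}.

Lemma integral_expR_iid_sum_le {d' : measure_display} {T' : measurableType d'}
    (N : nat) (Z : 'I_N -> {RV P >-> T'}) (f : T' -> R) (b : R) :
  mutually_independent Z -> measurable_fun setT f ->
  (forall j, \int[P]_w (expR (f (Z j w)))%:E <= (expR b)%:E)%E ->
  (\int[P]_w (expR (\sum_j f (Z j w)))%:E <= (expR (N%:R * b))%:E)%E.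
Proof.
move=> Zind mf fb.
have -> : expR (N%:R * b) = \prod_(j < N) expR b.
  by rewrite prodr_const card_ord expRM_natl.
under eq_integral => w _.
  rewrite expR_sum; under eq_bigr => j _ do rewrite -(tnth_mktuple (Z^~ w) j); over.
apply: (integral_adapted_prod Zind (f := fun j t => expR (f (tnth t j)))).
- move=> j; apply: measurableT_comp => //; apply: measurableT_comp => //.
  exact: measurable_tnth.
- by move=> j t; exact: expR_ge0.
- by move=> j; exact: expR_ge0.
- move=> j k t y jk; rewrite tnth_tuple_set ifN//.
  by rewrite -val_eqE /= ltn_eqF.
- by move=> j t; under eq_integral do rewrite tnth_tuple_set eqxx; exact: fb.
Qed.

Lemma one_sided_tail (S : T -> R) (u a b : R) : measurable_fun setT S -> 0 < u ->
  (\int[P]_w (expR (u * S w))%:E <= (expR b)%:E)%E ->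
  (P [set w | (a <= S w)%R] <= (expR (b - u * a))%:E)%E.
Proof.
move=> mS u0 Sb.
pose S' : {RV P >-> R} := HB.pack S (isMeasurableFun.Build _ _ _ _ S mS).
apply: le_trans (@chernoff _ _ _ P S' u a u0) _.
rewrite expRD EFinM lee_wpmul2r// ?lee_fin ?expR_ge0//.
rewrite /mmt_gen_fun expectation.unlock.
by under eq_integral do rewrite /= mulrC.
Qed.

Lemma measurable_ler (f g : T -> R) :
  measurable_fun setT f -> measurable_fun setT g ->
  measurable [set w | f w <= g w].
Proof.
move=> mf mg; rewrite -[X in measurable X]setTI.
rewrite (_ : [set w | _] = [set w | ((f w)%:E <= (g w)%:E)%E]); last first.
  by apply/seteqP; split => w /=; rewrite lee_fin.
by apply: measurable_lee => //; exact/measurable_EFinP.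
Qed.

(** Requiring the bound for all [s] with [s ^+ 2 = u ^+ 2] covers [u] and [- u], hence both tails,
    by one hypothesis. *)
Lemma two_sided_tail (S : T -> R) (u a b : R) : measurable_fun setT S -> 0 < u ->
  (forall s : R, s ^+ 2 = u ^+ 2 ->
     (\int[P]_w (expR (s * S w))%:E <= (expR b)%:E)%E) ->
  (P [set w | (a < `|S w|)%R] <= (2 * expR (b - u * a))%:E)%E.
Proof.
move=> mS u0 Sb.
have mN : measurable_fun setT (fun w => - S w) by exact: measurable_funN.
have m1 : measurable [set w | a <= S w] by exact: measurable_ler.
have m2 : measurable [set w | a <= - S w] by exact: measurable_ler.
have m3 : measurable [set w | a < `|S w|].
  rewrite (_ : [set w | _] = ~` [set w | `|S w| <= a]).
    by apply: measurableC; apply: measurable_ler => //; exact: measurableT_comp.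
  by apply/seteqP; split => w /=; rewrite real_ltNge ?num_real// => /negP.
have sub : [set w | a < `|S w|] `<=` [set w | a <= S w] `|` [set w | a <= - S w].
  by move=> w /=; rewrite lter_normr => /orP[] /ltW; [left|right].
apply: (@le_trans _ _ (P ([set w | a <= S w] `|` [set w | a <= - S w]))).
  by apply: le_measure => //; rewrite inE//; exact: measurableU.
apply: le_trans (measureU2 _ m1 m2) _.
rewrite mulr_natl mulr2n EFinD leeD//; apply: one_sided_tail => //.
- exact: Sb.
- under eq_integral do rewrite mulrN -mulNr.
  by apply: Sb; rewrite sqrrN.
Qed.

Lemma union_bound (m : nat) (G : 'I_m -> set T) (p : R) :
  (forall i, measurable (G i)) -> (forall i, P (~` G i) <= p%:E)%E ->
  ((1 - m%:R * p)%:E <= P [set w | forall i, G i w])%E.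
Proof.
(* Boole's inequality concerns sequences indexed by naturals, so the complements are padded with
   empty sets from [m] on. *)
move=> mG Gp; pose F k := oapp (fun i => ~` G i) set0 (insub k : option 'I_m).
have mF k : measurable (F k).
  by rewrite /F; case: insub => //= i; exact: measurableC.
have FE (i : 'I_m) : F i = ~` G i by rewrite /F valK.
have -> : [set w | forall i, G i w] = ~` (\big[setU/set0]_(i < m) F i).
  apply/seteqP; split => w /=.
    move=> h; rewrite -bigcup_seq => -[i _ /=].
    by rewrite FE => /(_ (h i)).
  move=> h i; apply: contrapT => Gi; apply: h.
  rewrite -bigcup_seq; exists i; first by rewrite /= mem_index_enum.
  by rewrite FE.
rewrite probability_setC; last exact: bigsetU_measurable.
rewrite EFinB leeB// (le_trans (Boole_inequality _ _))//.
rewrite (@le_trans _ _ (\sum_(i < m) p%:E)%E)//.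
  by apply: lee_sum => i _; rewrite FE; exact: Gp.
by rewrite sumEFin sumr_const card_ord mulr_natl.
Qed.

End deviation.

(** * Concentration of the estimator *)

Lemma sum_symmetric {R : comPzRingType} (n : nat) (a : 'I_n -> 'I_n -> R) :
  (forall i j, a i j = a j i) ->
  \sum_i \sum_j a i j = \sum_(i < n) (a i i + 2 * \sum_(j < n | (j < i)%N) a i j).
Proof.
move=> aC.
have split i : \sum_j a i j = a i i + \sum_(j < n | (j < i)%N) a i j +
    \sum_(j < n | (i < j)%N) a i j.
  rewrite (bigD1 i)//= -addrA; congr (_ + _).
  rewrite (bigID (fun j : 'I_n => (j < i)%N))/=; congr (_ + _);
    by apply: eq_bigl => j; rewrite -val_eqE /=; case: ltngtP.
under eq_bigr do rewrite split.
rewrite big_split/= [X in _ + X](_ : _ = \sum_(i < n) \sum_(j < n | (j < i)%N) a i j).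
  by rewrite -big_split/=; apply: eq_bigr => i _; ring.
rewrite (exchange_big_dep xpredT)//=; apply: eq_bigr => i _.
by apply: eq_bigr => j _.
Qed.

Lemma quadratic_form_centered {R : realType} (n : nat) (B : 'M[R]_n)
    (t : n.-tuple R) : symmetric_mx B ->
  ((\col_i tnth t i)^T *m B *m (\col_i tnth t i)) 0 0 - \tr B =
  centered_form B t.
Proof.
move=> BT; have BC i j : B i j = B j i by rewrite -[in LHS]BT mxE.
transitivity (\sum_i \sum_j tnth t i * B i j * tnth t j - \tr B).
  congr (_ - _); rewrite mxE exchange_big/=; apply: eq_bigr => j _.
  by rewrite !mxE mulr_suml; apply: eq_bigr => i _; rewrite !mxE.
rewrite sum_symmetric; last by move=> i j; rewrite BC; ring.
rewrite /mxtrace -sumrB; apply: eq_bigr => i _.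
rewrite /lower_form !mulr_sumr addrAC; congr (_ + _); first by ring.
by apply: eq_bigr => j _; ring.
Qed.

Lemma mxtrace_sqr_frobenius2 {R : realType} (n : nat) (B : 'M[R]_n) :
  symmetric_mx B -> \tr (B *m B) = frobenius2 B.
Proof.
move=> BT; rewrite /mxtrace; apply: eq_bigr => i _; rewrite mxE.
by apply: eq_bigr => j _; rewrite -{2}BT mxE expr2.
Qed.

Lemma symmetric_conj {R : realType} (n : nat) (A Y : 'M[R]_n) :
  symmetric_mx A -> symmetric_mx Y -> symmetric_mx (Y *m A *m Y).
Proof. by move=> AT YT; rewrite /symmetric_mx !trmx_mul AT YT mulmxA. Qed.

Lemma integral_sqr_standardized {d : measure_display} {T : measurableType d}
    {R : realType} {P : probability T R} (xi : {RV P >-> R}) :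
  ('E_P[xi] = 0)%E -> ('V_P[xi] = 1)%E -> (\int[P]_w (xi w ^+ 2)%:E = 1)%E.
Proof.
move=> E0; rewrite /variance covariance.unlock E0 expectation.unlock => <-.
by apply: eq_integral => w _ /=; rewrite fctE/= subr0 expr2.
Qed.

Lemma sub_gaussian_integral {d : measure_display} {T : measurableType d}
    {R : realType} {P : probability T R} (sigma : R) (xi : {RV P >-> R}) :
  sub_gaussian sigma xi -> forall t,
  (\int[P]_w (expR (t * xi w))%:E <= (expR (sigma ^+ 2 * t ^+ 2 / 2))%:E)%E.
Proof.
move=> xiv t; have := xiv t; rewrite /mmt_gen_fun expectation.unlock.
by under eq_integral do rewrite /= mulrC.
Qed.

(** For [u ^+ 2 = L / (N * F)] and [v = sigma ^+ 2], the smallness condition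
    [u ^+ 2 * F * (64 * v) ^+ 2 <= 1] says that [N] is at least this constant times [L]. *)
Definition sample_constant {R : realType} (sigma : R) : R :=
  (64 * sigma ^+ 2) ^+ 2.

(** The proxy pays for the exponential moment; the extra 2 is what remains in the tail exponent
    [- (2 * L)]. *)
Definition deviation_constant {R : realType} (sigma : R) : R :=
  chaos_proxy (sigma ^+ 2) + 2.

Section estimator_concentration.
Context {d : measure_display} {T : measurableType d} {R : realType}
  {P : probability T R}.
Variables (n m N : nat) (sigma : R) (A : 'I_m -> 'M[R]_n) (Y : 'M[R]_n)
  (z : 'I_N -> {RV P >-> n.-tuple R}).
Hypotheses (sigma_gt0 : 0 < sigma) (N_gt0 : (0 < N)%N).
Hypotheses (Asym : forall i, symmetric_mx (A i)) (Ysym : symmetric_mx Y).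
Hypothesis zP : iid_sub_gaussian_sample sigma z.

Let B i := Y *m A i *m Y.
Let Bsym i : symmetric_mx (B i). Proof. exact: symmetric_conj. Qed.

Lemma estimator_centered i x :
  estimator A Y z x i 0 - \tr (A i *m (Y *m Y)) =
  N%:R^-1 * \sum_j centered_form (B i) (z j x).
Proof.
have N0 : N%:R != 0 :> R by rewrite pnatr_eq0 -lt0n.
have -> : \tr (A i *m (Y *m Y)) = N%:R^-1 * \sum_(j < N) \tr (B i).
  rewrite sumr_const card_ord -(mulr_natl (\tr _)) mulKf//.
  by rewrite /B mulmxA mxtrace_mulC mulmxA.
rewrite mxE -mulrBr -sumrB; congr (_ * _); apply: eq_bigr => j _.
rewrite -quadratic_form_centered//; congr (fun_of_matrix _ 0 0 - _).
rewrite trmx_mul Ysym /B !mulmxA.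
have -> // : \col_i0 tnth (z j x) i0 = vec_of (z j) x.
by apply/matrixP => k l; rewrite !mxE.
Qed.

Lemma measurable_estimator i : measurable_fun setT (fun x => estimator A Y z x i 0).
Proof.
rewrite (_ : (fun x => _) = fun x => N%:R^-1 *
    (\sum_j centered_form (B i) (z j x)) + \tr (A i *m (Y *m Y))); last first.
  by apply/funext => x; rewrite -estimator_centered subrK.
apply: measurable_funD => //; apply: measurable_funM => //.
apply: measurable_sum => j.
exact: measurableT_comp (measurable_centered_form (B i)) (measurable_funP (z j)).
Qed.

Lemma frobenius2_conj i :
  frobenius2 (B i) = \tr (A i *m (Y *m Y) *m A i *m (Y *m Y)).
Proof.
rewrite -mxtrace_sqr_frobenius2// /B !mulmxA [RHS]mxtrace_mulC.
by rewrite !mulmxA.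
Qed.

Let joint_entry j w : joint (entry_RV (z j)) w = z j w.
Proof. by apply: eq_from_tnth => i; rewrite tnth_mktuple. Qed.

Lemma estimator_tail i (L : R) : 0 < L -> sample_constant sigma * L < N%:R ->
  (P (~` [set x | (`| estimator A Y z x i 0 - \tr (A i *m (Y *m Y)) | <=
     deviation_constant sigma * Num.sqrt L *
     Num.sqrt (\tr (A i *m (Y *m Y) *m A i *m (Y *m Y)) / N%:R))%R]) <=
   (2 * expR (- (2 * L)))%:E)%E.
Proof.
move=> L0 LN; rewrite -frobenius2_conj; set F := frobenius2 (B i).
pose S x := \sum_j centered_form (B i) (z j x).
have N0 : 0 < N%:R :> R by rewrite ltr0n.
have v0 : 0 < sigma ^+ 2 by rewrite exprn_gt0.
have [[zind _] zj] := zP.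
have F0 : 0 <= F by apply: sumr_ge0 => k _; apply: sumr_ge0 => l _; exact: sqr_ge0.
have mS : measurable_fun setT S.
  apply: measurable_sum => j.
  exact: measurableT_comp (measurable_centered_form (B i)) (measurable_funP (z j)).
(* If [F] vanishes, so does [B i]; the estimator is then exact and the bad event empty. Otherwise
   [u] below may divide by [F]. *)
have [F00|F_neq0] := eqVneq F 0.
  rewrite [X in P X](_ : _ = set0); first by rewrite measure0 lee_fin mulr_ge0// expR_ge0.
  apply/seteqP; split => x //=; case; rewrite estimator_centered F00 mul0r sqrtr0 mulr0.
  have B0 k l : B i k l = 0.
    move/eqP: F00; rewrite psumr_eq0; last first.
      by move=> k' _; apply: sumr_ge0 => l' _; exact: sqr_ge0.
    move=> /allP/(_ k); rewrite mem_index_enum => /(_ isT)/=.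
    rewrite psumr_eq0; last by move=> l' _; exact: sqr_ge0.
    move=> /allP/(_ l); rewrite mem_index_enum => /(_ isT)/=.
    by rewrite sqrf_eq0 => /eqP.
  rewrite big1 ?mulr0 ?normr0// => j _; rewrite /centered_form big1// => k _.
  rewrite B0 mul0r /lower_form big1 ?mulr0 ?addr0// => l _.
  by rewrite B0 mul0r.
have {F_neq0}F0 : 0 < F by rewrite lt_neqAle eq_sym F_neq0.
(* This makes the total moment exponent [N * (chaos_proxy * u ^+ 2 * F)] equal to [chaos_proxy * L],
   of the same order as [u * a]. *)
pose u := Num.sqrt (L / (N%:R * F)).
have NF0 : 0 < N%:R * F by rewrite mulr_gt0.
have u0 : 0 < u by rewrite sqrtr_gt0 divr_gt0.
have u2 : u ^+ 2 = L / (N%:R * F) by rewrite sqr_sqrtr// divr_ge0// ltW.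
(* The threshold for the unnormalised sum [S], that is, [N] times the stated deviation. *)
pose a := deviation_constant sigma * Num.sqrt (L * (N%:R * F)).
have ua : u * a = deviation_constant sigma * L.
  rewrite /a mulrCA -sqrtrM; last by rewrite divr_ge0// ltW.
  rewrite (_ : L / (N%:R * F) * (L * (N%:R * F)) = L ^+ 2).
    by rewrite sqrtr_sqr gtr0_norm.
  by field; rewrite !gt_eqF.
have -> : 2 * expR (- (2 * L)) = 2 * expR (N%:R * (chaos_proxy (sigma ^+ 2) *
    u ^+ 2 * F) - u * a).
  congr (_ * expR _); rewrite ua u2 /deviation_constant.
  by field; rewrite !gt_eqF.
rewrite [X in P X](_ : _ = [set x | a < `|S x|]).
  apply: two_sided_tail => // s su; rewrite -su.
  under eq_integral do rewrite /S mulr_sumr.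
  apply: (integral_expR_iid_sum_le (f := fun t => s * centered_form (B i) t)
    zind) => [|j].
    by apply: measurable_funM => //; exact: measurable_centered_form.
  have [[eind _] eP] := zj j.
  under eq_integral do rewrite -joint_entry.
  apply: integral_expR_centered_form_le => // [k t|k|].
  - by have [_ _ /sub_gaussian_integral] := eP k; exact.
  - by have [E0 V1 _] := eP k; exact: integral_sqr_standardized.
  - rewrite su u2 -/(sample_constant sigma).
    rewrite (_ : _ * _ = sample_constant sigma * L / N%:R).
      by rewrite ler_pdivrMr// mul1r ltW.
    by field; rewrite !gt_eqF.
apply/seteqP; split => x /=; rewrite estimator_centered normrM gtr0_norm ?invr_gt0//.
all: rewrite ler_pdivrMl// -mulrA.
all: rewrite (_ : N%:R * _ = a) ?real_ltNge ?num_real//; try by move/negP.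
all: rewrite mulrCA /a; congr (_ * _); rewrite -sqrtrM ?(ltW L0)//.
all: rewrite -{1}(gtr0_norm N0) -sqrtr_sqr -sqrtrM ?sqr_ge0//; congr Num.sqrt.
all: by field; rewrite gt_eqF.
Qed.

End estimator_concentration.

Section main_bounds.
Context {d : measure_display} {T : measurableType d} {R : realType}
  {P : probability T R}.

(** The exponent [2 * L] makes each failure cost [2 * (delta / m) ^+ 2]. The total
    [2 * delta ^+ 2 / m] is at most [delta] because [delta <= 1 / 2]. *)
Lemma failure_budget (m : nat) (delta : R) : (0 < m)%N -> 0 < delta <= 1 / 2 ->
  0 < ln (m%:R / delta) /\
  m%:R * (2 * expR (- (2 * ln (m%:R / delta)))) <= delta.
Proof.
move=> m0 /andP[d0 d1]; have m1 : 1 <= m%:R :> R by rewrite ler1n.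
have md0 : 0 < m%:R / delta by rewrite divr_gt0// (lt_le_trans ltr01).
split; first by rewrite ln_gt0// ltr_pdivlMr// mul1r; lra.
have -> : expR (- (2 * ln (m%:R / delta))) = (m%:R / delta) ^- 2.
  by rewrite expRN expRM_natl lnK.
rewrite (_ : _ * _ = delta * (2 * delta / m%:R)); last first.
  by field; rewrite !gt_eqF//; lra.
by rewrite ler_piMr ?(ltW d0)// ler_pdivrMr; lra.
Qed.

Lemma estimator_concentration (n m N : nat) (sigma : R) (A : 'I_m -> 'M[R]_n)
    (Y : 'M[R]_n) (z : 'I_N -> {RV P >-> n.-tuple R}) (delta : R) :
  0 < sigma -> (0 < m)%N -> (0 < N)%N -> (forall i, symmetric_mx (A i)) ->
  symmetric_mx Y -> 0 < delta <= 1 / 2 -> iid_sub_gaussian_sample sigma z ->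
  sample_constant sigma * ln (m%:R / delta) < N%:R ->
  ((1 - delta)%:E <=
    P [set x | forall i : 'I_m,
      (`| estimator A Y z x i 0 - \tr (A i *m (Y *m Y)) | <=
       deviation_constant sigma * Num.sqrt (ln (m%:R / delta)) *
       Num.sqrt (\tr (A i *m (Y *m Y) *m A i *m (Y *m Y)) / N%:R))%R])%E.
Proof.
move=> s0 m0 N0 As Ys hd zP LN; have [L0 budget] := failure_budget m0 hd.
apply: le_trans (union_bound _ (fun i => estimator_tail s0 N0 As Ys zP i L0 LN)).
  by rewrite lee_fin lerD2l lerN2.
move=> i; apply: measurable_ler => //; apply: measurableT_comp => //.
by apply: measurable_funB => //; exact: measurable_estimator.
Qed.

Lemma measurable_event_forall (m : nat) (G : 'I_m -> set T) :
  (forall i, measurable (G i)) -> measurable [set x | forall i, G i x].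
Proof.
move=> mG; rewrite (_ : [set x | _] = \bigcap_(i in [set: 'I_m]) G i).
  by apply: fin_bigcap_measurable => // i _; exact: mG.
by apply/seteqP; split => x /= h i => [_|]; exact: h.
Qed.

End main_bounds.

(** * The diagonal case and the final bounds *)

Lemma mxtrace_delta {R : realType} (n : nat) (i : 'I_n) (X : 'M[R]_n) :
  \tr (delta_mx i i *m X) = X i i.
Proof.
rewrite /mxtrace (bigD1 i)//= big1 ?addr0 => [|k ki].
  rewrite mxE (bigD1 i)//= big1 ?addr0 => [|k ki].
    by rewrite !mxE !eqxx mul1r.
  by rewrite mxE (negbTE ki) andbF mul0r.
by rewrite mxE big1// => l _; rewrite mxE (negbTE ki) mul0r.
Qed.

(** Its square root is the size of the estimated diagonal entry, so the general bound becomes a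
    relative error for each entry. *)
Lemma mxtrace_delta_sqr {R : realType} (n : nat) (i : 'I_n) (X : 'M[R]_n) :
  \tr (delta_mx i i *m X *m delta_mx i i *m X) = X i i ^+ 2.
Proof.
rewrite -!mulmxA mxtrace_delta mulmxA.
rewrite mxE (bigD1 i)//= big1 ?addr0 => [|k ki].
  rewrite mxE (bigD1 i)//= big1 ?addr0 => [|k ki].
    by rewrite mxE !eqxx mulr1 expr2.
  by rewrite mxE (negbTE ki) mulr0.
by rewrite mxE big1 ?mul0r// => l _; rewrite mxE (negbTE ki) andbF mulr0.
Qed.

Lemma norm2_le_of_entries {R : realType} (n : nat) (e x : 'cV[R]_n) (k : R) :
  0 <= k -> (forall i, `|e i 0| <= k * `|x i 0|) -> norm2 e <= k * norm2 x.
Proof.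
move=> k0 ex; rewrite /norm2 -{1}(ger0_norm k0) -sqrtr_sqr -sqrtrM ?sqr_ge0//.
apply: ler_wsqrtr; rewrite mulr_sumr; apply: ler_sum => i _.
rewrite -exprMn -[leLHS]real_normK ?num_real// -[leRHS]real_normK ?num_real//.
by rewrite lerXn2r ?nnegrE// normrM (ger0_norm k0).
Qed.

Theorem proposition1 (R : realType) (sigma : R) (sigma_gt0 : 0 < sigma) :
  exists c K : R, [/\ 0 < c, 0 < K,
    forall (n m N : nat) (r : regularization) (beta : R) (C : 'M[R]_n)
        (A : 'I_m -> 'M[R]_n) (lambda : 'cV[R]_m) (Y : 'M[R]_n) (delta : R)
        (d : measure_display) (T : measurableType d) (P : probability T R)
        (z : 'I_N -> {RV P >-> n.-tuple R}),
      (0 < n)%N -> (0 < m)%N -> (0 < N)%N -> 0 < beta ->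
      symmetric_mx C -> (forall i, symmetric_mx (A i)) ->
      let X := X_mx r beta C A lambda in
      is_posdef_sqrt X Y ->
      0 < delta <= 1 / 2 ->
      iid_sub_gaussian_sample sigma z ->
      c * ln (m%:R / delta) < N%:R ->
      ((1 - delta)%:E <=
        P [set x | forall i : 'I_m,
             (`| estimator A Y z x i 0 - \tr (A i *m X) | <=
              K * Num.sqrt (ln (m%:R / delta)) *
                Num.sqrt (\tr (A i *m X *m A i *m X) / N%:R))%R])%E &
    forall (n N : nat) (r : regularization) (beta : R) (C : 'M[R]_n)
        (lambda : 'cV[R]_n) (Y : 'M[R]_n) (delta : R)
        (d : measure_display) (T : measurableType d) (P : probability T R)
        (z : 'I_N -> {RV P >-> n.-tuple R}),
      (0 < n)%N -> (0 < N)%N -> 0 < beta ->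
      symmetric_mx C ->
      let A := fun i : 'I_n => delta_mx i i : 'M[R]_n in
      let X := X_mx r beta C A lambda in
      is_posdef_sqrt X Y ->
      0 < delta <= 1 / 2 ->
      iid_sub_gaussian_sample sigma z ->
      c * ln (n%:R / delta) < N%:R ->
      ((1 - delta)%:E <=
        P [set x |
             (norm2 (estimator A Y z x - diag_vec X) / norm2 (diag_vec X) <=
              K * Num.sqrt (ln (n%:R / delta) / N%:R))%R])%E].
Proof.
have s2 : 0 < sigma ^+ 2 by rewrite exprn_gt0.
have K0 : 0 < deviation_constant sigma.
  have q0 := sqr_proxy_gt0 s2; have := exprn_gt0 2 s2.
  by rewrite /deviation_constant /chaos_proxy; lra.
exists (sample_constant sigma), (deviation_constant sigma); split => //.
- by rewrite exprn_gt0// mulr_gt0.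
- move=> n m N r beta C A lambda Y delta d T P z n0 m0 N0 _ _ As X.
  by move=> [[Ys _] <-] hd zP LN; exact: estimator_concentration.
move=> n N r beta C lambda Y delta d T P z n0 N0 _ _ A X.
move=> [[Ys _] <-] hd zP LN; set W := Y *m Y.
have As i : symmetric_mx (A i) by rewrite /symmetric_mx trmx_delta.
have [L0 _] := failure_budget n0 hd.
have N0' : 0 < N%:R :> R by rewrite ltr0n.
have mest i : measurable_fun setT (fun x => estimator A Y z x i 0).
  exact: measurable_estimator.
(* The norm bound holds at every point of the event where all entrywise bounds hold, so inclusion of
   events suffices and no probability is lost. *)
apply: le_trans (estimator_concentration sigma_gt0 n0 N0 As Ys hd zP LN) _.
have msqrt : measurable_fun setT (@Num.sqrt R).
  by apply: continuous_measurable_fun; exact: sqrt_continuous.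
set L := ln _ in L0 *; set K := deviation_constant sigma in K0 *.
apply: le_measure; rewrite ?inE.
- apply: measurable_event_forall => i; apply: measurable_ler => //.
  by apply: measurableT_comp => //; exact: measurable_funB.
- apply: measurable_ler => //; apply: measurable_funM => //.
  apply: (measurableT_comp msqrt).
  apply: measurable_sum => i; apply: measurable_funX.
  under eq_fun do rewrite mxE [X in _ + X]mxE.
  exact: measurable_funD.
move=> x /= h.
have main : norm2 (estimator A Y z x - diag_vec W) <=
    K * Num.sqrt (L / N%:R) * norm2 (diag_vec W).
  apply: norm2_le_of_entries => [|i].
    by rewrite mulr_ge0 ?sqrtr_ge0// ltW.
  have := h i; rewrite /A -/W mxtrace_delta mxtrace_delta_sqr.
  have dE : diag_vec W i 0 = W i i by rewrite mxE.
  rewrite [(_ - diag_vec W) i 0]mxE [(- diag_vec W) i 0]mxE dE.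
  move=> /le_trans; apply.
  rewrite sqrtrM ?sqr_ge0// sqrtr_sqr sqrtrM ?(ltW L0)//.
  by rewrite le_eqVlt; apply/orP; left; apply/eqP; ring.
(* With a zero denominator the quotient is 0 by convention, and the right side is nonnegative. *)
have [->|W0] := eqVneq (norm2 (diag_vec W)) 0.
  by rewrite invr0 mulr0 mulr_ge0 ?sqrtr_ge0// ltW.
by rewrite ler_pdivrMr// lt_neqAle eq_sym W0 sqrtr_ge0.
Qed.
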